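(* Consider the white noise model or the Gaussian sequence model with noise level $n^{-1/2}$, and let $T$ be a linear functional. The minimax linear risk for estimating $T$ over a parameter set $\mathcal{F}$ is the same as the minimax linear risk over the convex hull of $\mathcal{F}$, that is, $$R_A^*(n;\mathcal{F})=R_A^*(n;\mathrm{C.Hull}(\mathcal{F})).$$
   Context: White noise model: one observes $dY(t)=f(t)\,dt+n^{-1/2}dW(t)$ on an interval, $W$ a standard Brownian motion. Sequence model: one observes $Y(i)=f(i)+n^{-1/2}\varepsilon_i$, $\varepsilon_i$ i.i.d. standard normal. Parameter sets are subsets of $L_2$ (resp. $\ell_2$), and $T$ is a linear functional on a linear space containing the parameter set. A linear (affine) estimator has the form $\hat T=a+\int u(t)\,dY(t)$, resp. $\hat T=a+\sum_i u(i)Y(i)$, with $a\in\mathbb{R}$ and $u$ in $L_2$ (resp. $\ell_2$). The minimax linear risk is $R_A^*(n;\mathcal{F})=\inf_{\hat T}\sup_{f\in\mathcal{F}}E_f(\hat T-Tf)^2$, the infimum being over all linear (affine) estimators $\hat T$; $E_f$ is expectation when the true parameter is $f$. $\mathrm{C.Hull}(\mathcal{F})$ is the convex hull of $\mathcal{F}$ (finite convex combinations). *)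

(* Defs.v *)
From HB Require Import structures.
From mathcomp Require Import all_boot all_order all_algebra.
From mathcomp Require Import all_classical all_reals all_analysis.

Set Implicit Arguments.
Unset Strict Implicit.
Unset Printing Implicit Defensive.

Import Order.TTheory GRing.Theory Num.Theory.
Import numFieldNormedType.Exports.

Local Open Scope classical_set_scope.
Local Open Scope ring_scope.

Definition convex_hull (R : realType) (X : lmodType R) (F : set X) : set X :=
  [set f | exists (m : nat) (c : 'I_m -> R) (g : 'I_m -> X),
    [/\ forall i, F (g i), forall i, 0 <= c i,
        \sum_(i < m) c i = 1 & f = \sum_(i < m) c i *: g i]].

(* [L] is only required to be linear on the subspace [V]; its values off [V]
   are irrelevant (e.g. point evaluation on continuous functions). *)
Definition linear_functional_on (R : realType) (X : lmodType R)
    (V : set X) (L : X -> R) : Prop :=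
  [/\ V 0, forall (a : R) f g, V f -> V g -> V (a *: f + g) &
      forall (a : R) f g, V f -> V g -> L (a *: f + g) = a * L f + L g].

(* Square-integrable functions on [I].  Elements are functions, not a.e.
   classes; their values outside [I] play no role in the observation. *)
Definition L2 (R : realType) (I : interval R) : set (R -> R) :=
  [set f : R -> R | measurable_fun [set` I] f /\
    (@lebesgue_measure R).-integrable [set` I] (fun t => (f t ^+ 2)%:E)].

Definition ell2 (R : realType) : set (nat -> R) :=
  [set f : nat -> R | cvgn (series (fun i => f i ^+ 2))].

Section probability_notions.
Context d (T : measurableType d) (R : realType) (P : probability T R).

Definition independent_RVs (J : eqType) (X : J -> T -> R) : Prop :=
  forall (s : seq J) (A : J -> set R),
    uniq s -> (forall j, measurable (A j)) ->
    P (\bigcap_(j in [set` s]) (X j @^-1` A j)) =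
    (\prod_(j <- s) P (X j @^-1` A j))%E.

(* Normal law; as in [normal_prob], [s] is the standard deviation. *)
Definition normal_RV (m s : R) (X : T -> R) : Prop :=
  forall A : set R, measurable A -> pushforward P X A = normal_prob m s A.

Definition increment (W : R -> {RV P >-> R}) (s t : R) (w : T) : R :=
  W t w - W s w.

(* Standard Brownian motion indexed by the interval [I] and started from 0 at
   [t0]; it is two-sided when [t0] is interior to [I]. *)
Definition brownian_motion (I : interval R) (t0 : R)
    (W : R -> {RV P >-> R}) : Prop :=
  [/\ t0 \in I /\ {ae P, forall w, W t0 w = 0},
      forall (m : nat) (t : nat -> R),
        (forall j, t j \in I) -> nondecreasing_seq t ->
        independent_RVs (fun j : 'I_m => increment W (t j) (t j.+1)),
      forall s t, s \in I -> t \in I -> s < t ->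
        normal_RV 0 (Num.sqrt (t - s)) (increment W s t) &
      {ae P, forall w, {within [set` I], continuous (fun t => W t w)}}].

Definition gaussian_white_sequence (eps : nat -> {RV P >-> R}) : Prop :=
  independent_RVs (fun i => eps i : T -> R) /\ forall i, normal_RV 0 1 (eps i).

Definition mean_square_cvg (Z_ : nat -> T -> R) (Z : T -> R) : Prop :=
  measurable_fun [set: T] Z /\
  ('E_P[fun w => ((Z_ k w - Z w) ^+ 2)%R])%E @[k --> \oo] --> 0%E.

End probability_notions.

Definition step_fun (R : realType) (m : nat) (c t : nat -> R) (x : R) : R :=
  \sum_(j < m) c j * \1_(`]t j, t j.+1]%classic) x.

Definition step_integral (R : realType) (m : nat) (c t y : nat -> R) : R :=
  \sum_(j < m) c j * (y j.+1 - y j).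

Section models.
Context d (T : measurableType d) (R : realType) (P : probability T R).

(* [Z] is a version of the integral over [I] of the deterministic function [u]
   against the process with paths [Y w]: the mean-square limit of
   \sum_j c_j (Y(t_{j+1}) - Y(t_j)) along step functions
   \sum_j c_j 1_{]t_j, t_{j+1}]} tending to [u] in L2(I). *)
Definition is_stochastic_integral (I : interval R) (u : R -> R)
    (Y : T -> R -> R) (Z : T -> R) : Prop :=
  exists (m : nat -> nat) (c t : nat -> nat -> R),
  [/\ forall k, nondecreasing_seq (t k) /\ forall j, t k j \in I,
      (\int[@lebesgue_measure R]_(x in [set` I])
         ((step_fun (m k) (c k) (t k) x - u x) ^+ 2)%:E)%E
         @[k --> \oo] --> 0%E &
      mean_square_cvg P
        (fun k w => step_integral (m k) (c k) (t k) (fun j => Y w (t k j))) Z].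

(* \int_{t0}^t f, with the usual sign when [t < t0]. *)
Definition drift (f : R -> R) (t0 t : R) : R :=
  if t0 <= t then Rintegral (@lebesgue_measure R) `[t0, t] f
  else - Rintegral (@lebesgue_measure R) `[t, t0] f.

(* Path on [I] of dY = f dt + n^{-1/2} dW, Y(t0) = 0; padded with 0 off [I]. *)
Definition wn_observation (n : R) (I : interval R) (t0 : R)
    (W : R -> {RV P >-> R}) (f : R -> R) (w : T) : R -> R :=
  (fun t => drift f t0 t + n `^ (- 2^-1) * W t w) \_ [set` I].

Definition seq_observation (n : R) (eps : nat -> {RV P >-> R})
    (f : nat -> R) (w : T) : nat -> R :=
  fun i => f i + n `^ (- 2^-1) * eps i w.

(* An estimator is a function of the observed path; it is linear when, for some
   [a] and [u], it is a version of a + \int u dY under every parameter [f]. *)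
Definition wn_linear_estimator (n : R) (I : interval R) (t0 : R)
    (W : R -> {RV P >-> R}) : set ((R -> R) -> R) :=
  [set That | exists (a : R) (u : R -> R), L2 I u /\
    forall f, L2 I f ->
      is_stochastic_integral I u (wn_observation n I t0 W f)
        (fun w => That (wn_observation n I t0 W f w) - a)].

(* The series \sum_i u(i) Y(i) is the mean-square limit of its partial sums. *)
Definition seq_linear_estimator (n : R) (eps : nat -> {RV P >-> R}) :
    set ((nat -> R) -> R) :=
  [set That | exists (a : R) (u : nat -> R), ell2 u /\
    forall f, ell2 f ->
      mean_square_cvg P
        (fun N w => \sum_(i < N) u i * seq_observation n eps f w i)
        (fun w => That (seq_observation n eps f w) - a)].

Definition mse (X D : Type) (Y : X -> T -> D) (L : X -> R)
    (That : D -> R) (f : X) : \bar R :=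
  ('E_P[fun w => ((That (Y f w) - L f) ^+ 2)%R])%E.

Definition minimax_risk (X D : Type) (Y : X -> T -> D) (E : set (D -> R))
    (L : X -> R) (F : set X) : \bar R :=
  ereal_inf [set ereal_sup [set mse Y L That f | f in F] | That in E].

Definition wn_linear_minimax_risk (n : R) (I : interval R) (t0 : R)
    (W : R -> {RV P >-> R}) (L : (R -> R) -> R) (F : set (R -> R)) : \bar R :=
  minimax_risk (wn_observation n I t0 W) (wn_linear_estimator n I t0 W) L F.

Definition seq_linear_minimax_risk (n : R) (eps : nat -> {RV P >-> R})
    (L : (nat -> R) -> R) (F : set (nat -> R)) : \bar R :=
  minimax_risk (seq_observation n eps) (seq_linear_estimator n eps) L F.

End models.

(* Main.v *)
(** For a fixed affine estimator the error [That - L f] is, almost surely, an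
    affine function of the parameter [f], because [\sum_i u i * Y i] and
    [\int u dY] are; by Jensen its mean square is a convex function of [f], so
    its supremum over the convex hull of [F] is its supremum over [F].

    In the white noise model, affine dependence on [f] requires [\int u dY] to be
    computed along the same step functions for all parameters involved, whereas
    its definition lets them vary with [f].  The choice is immaterial: for a
    step function [s] supported in [I], the drift part of [\int s dY] is
    controlled by Cauchy-Schwarz and its Brownian part by the isometry
    [E (\int s dW)^2 = C * \int s^2].  The latter only needs the variances of
    the increments, since the polarization
    [2 (b-a)(e-c) = (e-a)^2 + (b-c)^2 - (b-e)^2 - (a-c)^2] turns them into
    covariances. *)

Require Import Defs.
From HB Require Import structures.
From mathcomp Require Import all_boot all_order all_algebra.
From mathcomp Require Import all_classical all_reals all_analysis.
From mathcomp Require Import measurable_realfun ring lra.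

Set Implicit Arguments.
Unset Strict Implicit.
Unset Printing Implicit Defensive.

Import Order.TTheory GRing.Theory Num.Theory.
Import numFieldNormedType.Exports.

Local Open Scope classical_set_scope.
Local Open Scope ring_scope.

(** * Mean-square limits *)

(** Jensen for the square: the weighted variance of [x] about its mean [b] is nonnegative, and it
    expands to the difference of the two sides. *)
Lemma sqr_convex_le (R : realType) (m : nat) (c x : 'I_m -> R) :
  (forall i, 0 <= c i) -> \sum_(i < m) c i = 1 ->
  (\sum_(i < m) c i * x i) ^+ 2 <= \sum_(i < m) c i * x i ^+ 2.
Proof.
move=> c0 c1; set b := \sum_(i < m) c i * x i.
have: 0 <= \sum_(i < m) c i * (x i - b) ^+ 2.
  by apply: sumr_ge0 => i _; rewrite mulr_ge0 ?sqr_ge0.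
under eq_bigr => i _.
  rewrite (_ : _ * _ = c i * x i ^+ 2 + ((- (2 * b)) * (c i * x i) + b ^+ 2 * c i));
    last by ring.
  over.
rewrite !big_split -!mulr_sumr /= c1 -/b => h.
by rewrite -subr_ge0; apply: le_trans h _; rewrite le_eqVlt; apply/orP; left;
  apply/eqP; ring.
Qed.

Section square_integral.
Context d (T : measurableType d) (R : realType) (mu : {measure set T -> \bar R}).
Variable D : set T.
Hypothesis mD : measurable D.

Let msq (f : T -> R) : measurable_fun D f ->
  measurable_fun D (fun x => (f x ^+ 2)%:E).
Proof. by move=> mf; apply/measurable_EFinP; exact: measurable_funX. Qed.

(** Pointwise Jensen, integrated. Working in the extended reals allows infinite second moments,
    hence infinite risks. *)
Lemma integral_sqr_convex (m : nat) (c : 'I_m -> R) (f : 'I_m -> T -> R) :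
  (forall i, 0 <= c i) -> \sum_(i < m) c i = 1 ->
  (forall i, measurable_fun D (f i)) ->
  (\int[mu]_(x in D) ((\sum_(i < m) c i * f i x) ^+ 2)%:E <=
   \sum_(i < m) (c i)%:E * \int[mu]_(x in D) (f i x ^+ 2)%:E)%E.
Proof.
move=> c0 c1 mf.
have -> : (\sum_(i < m) (c i)%:E * \int[mu]_(x in D) (f i x ^+ 2)%:E =
   \int[mu]_(x in D) \sum_(i < m) ((c i)%:E * (f i x ^+ 2)%:E))%E.
  rewrite ge0_integral_sum//; last 2 first.
  - by move=> i; apply: measurable_funeM; exact: msq.
  - by move=> i x _; rewrite mule_ge0 ?lee_fin ?sqr_ge0.
  apply: eq_bigr => i _; rewrite ge0_integralZl ?lee_fin//; first exact: msq.
  by move=> x _; rewrite lee_fin sqr_ge0.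
apply: ge0_le_integral => //.
- by move=> x _; rewrite lee_fin sqr_ge0.
- apply: msq; apply: measurable_sum => i.
  by apply: measurable_funM => //; exact: measurable_cst.
- by apply: emeasurable_sum => i; apply: measurable_funeM; exact: msq.
- move=> x _; under [leRHS]eq_bigr do rewrite -EFinM.
  by rewrite sumEFin lee_fin; exact: sqr_convex_le.
Qed.

Lemma integral_sqrZ (a : R) (f : T -> R) : measurable_fun D f ->
  (\int[mu]_(x in D) ((a * f x) ^+ 2)%:E =
   (a ^+ 2)%:E * \int[mu]_(x in D) (f x ^+ 2)%:E)%E.
Proof.
move=> mf; under eq_integral do rewrite exprMn EFinM.
rewrite ge0_integralZl ?lee_fin ?sqr_ge0//; first exact: msq.
by move=> x _; rewrite lee_fin sqr_ge0.
Qed.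

(** The gap between the integrands is [(f x - g x) ^+ 2]. This crude triangle inequality also covers
    infinite integrals. *)
Lemma integral_sqrD_le (f g : T -> R) :
  measurable_fun D f -> measurable_fun D g ->
  (\int[mu]_(x in D) ((f x + g x) ^+ 2)%:E <=
   2%:E * \int[mu]_(x in D) (f x ^+ 2)%:E +
   2%:E * \int[mu]_(x in D) (g x ^+ 2)%:E)%E.
Proof.
move=> mf mg.
rewrite -!ge0_integralZl ?lee_fin//; [|exact: msq|by move=> x _; rewrite lee_fin sqr_ge0
  |exact: msq|by move=> x _; rewrite lee_fin sqr_ge0].
rewrite -ge0_integralD//; [|by move=> x _; rewrite mule_ge0 ?lee_fin ?sqr_ge0
  |by apply: measurable_funeM; exact: msq
  |by move=> x _; rewrite mule_ge0 ?lee_fin ?sqr_ge0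
  |by apply: measurable_funeM; exact: msq].
apply: ge0_le_integral => //.
- by move=> x _; rewrite lee_fin sqr_ge0.
- by apply: msq; exact: measurable_funD.
- by apply: emeasurable_funD; apply: measurable_funeM; exact: msq.
- move=> x _; rewrite -!EFinM -EFinD lee_fin -subr_ge0.
  by rewrite (_ : _ - _ = (f x - g x) ^+ 2) ?sqr_ge0//; ring.
Qed.

Lemma integral_sqr_eq0 (f : T -> R) : measurable_fun D f ->
  (\int[mu]_(x in D) (f x ^+ 2)%:E = 0)%E -> {ae mu, forall x, D x -> f x = 0}.
Proof.
move=> mf f0.
have /(ae_eq_integral_abs mu mD (msq mf)) : (\int[mu]_(x in D) `|(f x ^+ 2)%:E| = 0)%E.
  by under eq_integral do rewrite gee0_abs ?lee_fin ?sqr_ge0//.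
apply: filterS => x /[apply] -[] /eqP.
by rewrite sqrf_eq0 => /eqP.
Qed.

End square_integral.

Lemma expectation_sqr d (T : measurableType d) (R : realType)
    (P : probability T R) (X : T -> R) :
  ('E_P[fun w => (X w ^+ 2)%R] = \int[P]_w (X w ^+ 2)%:E)%E.
Proof. by rewrite unlock. Qed.

Section mean_square_limits.
Context d (T : measurableType d) (R : realType) (P : probability T R).

(** Mean-square limits are almost surely unique, so a convex relation between the approximants
    passes to the limits. *)
Lemma mean_square_cvg_convex (m : nat) (c : 'I_m -> R)
    (S : nat -> T -> R) (S_ : 'I_m -> nat -> T -> R)
    (Z : T -> R) (Z_ : 'I_m -> T -> R) :
  (forall i, 0 <= c i) -> \sum_(i < m) c i = 1 ->
  (forall i k, measurable_fun setT (S_ i k)) ->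
  (forall k w, S k w = \sum_(i < m) c i * S_ i k w) ->
  mean_square_cvg P S Z -> (forall i, mean_square_cvg P (S_ i) (Z_ i)) ->
  {ae P, forall w, Z w = \sum_(i < m) c i * Z_ i w}.
Proof.
move=> c0 c1 mS SE [mZ SZ] h_.
have mS' k : measurable_fun setT (S k).
  rewrite (_ : S k = fun w => \sum_(i < m) c i * S_ i k w); last first.
    by apply/funext => w; exact: SE.
  by apply: measurable_sum => i; apply: measurable_funM => //; exact: measurable_cst.
have mZ_ i : measurable_fun setT (Z_ i) by case: (h_ i).
have mZs : measurable_fun setT (fun w => \sum_(i < m) c i * Z_ i w).
  by apply: measurable_sum => i; apply: measurable_funM => //; exact: measurable_cst.
(* Split [Z - \sum_i c i * Z_ i] as [(Z - S k) + \sum_i c i * (S_ i k - Z_ i)]: by [SE] the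
   approximants cancel. *)
have bound k : (\int[P]_w ((Z w - \sum_(i < m) c i * Z_ i w) ^+ 2)%:E <=
    2%:E * \int[P]_w ((S k w - Z w) ^+ 2)%:E +
    2%:E * \sum_(i < m) (c i)%:E * \int[P]_w ((S_ i k w - Z_ i w) ^+ 2)%:E)%E.
  pose f w := Z w - S k w; pose g w := \sum_(i < m) c i * (S_ i k w - Z_ i w).
  have mg : measurable_fun setT g.
    apply: measurable_sum => i; apply: measurable_funM; first exact: measurable_cst.
    exact: measurable_funB.
  have -> : (\int[P]_w ((S k w - Z w) ^+ 2)%:E = \int[P]_w (f w ^+ 2)%:E)%E.
    by apply: eq_integral => w _; rewrite /f -sqrrN opprB.
  have -> : (\int[P]_w ((Z w - \sum_(i < m) c i * Z_ i w) ^+ 2)%:E =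
      \int[P]_w ((f w + g w) ^+ 2)%:E)%E.
    apply: eq_integral => w _; congr ((_ ^+ 2)%:E); rewrite /f /g SE.
    have -> : \sum_(i < m) c i * (S_ i k w - Z_ i w) =
        \sum_(i < m) c i * S_ i k w - \sum_(i < m) c i * Z_ i w.
      by rewrite -sumrB; apply: eq_bigr => i _; rewrite mulrBr.
    by ring.
  apply: le_trans (integral_sqrD_le _ _ _ _) _ => //; first exact: measurable_funB.
  rewrite leeD2l// lee_pmul2l// integral_sqr_convex// => i.
  exact: measurable_funB.
have lim0 : (2%:E * \int[P]_w ((S k w - Z w) ^+ 2)%:E +
    2%:E * \sum_(i < m) (c i)%:E * \int[P]_w ((S_ i k w - Z_ i w) ^+ 2)%:E)%E
    @[k --> \oo] --> 0%E.
  rewrite -[X in _ --> X]adde0 -[in X in (X + _)%E](mule0 2%:E).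
  rewrite -[in X in (_ + X)%E](mule0 2%:E).
  apply: cvgeD => //.
    apply: cvgeZl => //.
    by under eq_fun do rewrite -expectation_sqr.
  apply: cvgeZl => //.
  rewrite [X in _ --> X](_ : _ = \sum_(i < m) 0)%E; last by rewrite big1.
  apply: cvg_nnesum.
  - move=> i _; near=> k.
    rewrite mule_ge0 ?lee_fin//; apply: integral_ge0 => w _.
    by rewrite lee_fin sqr_ge0.
  - move=> i _; rewrite -[X in _ --> X](mule0 (c i)%:E); apply: cvgeZl => //.
    by under eq_fun do rewrite -expectation_sqr; case: (h_ i).
(* The left side of [bound] does not depend on [k], while its right side tends to 0. *)
have /(integral_sqr_eq0 measurableT) :
    (\int[P]_w ((Z w - \sum_(i < m) c i * Z_ i w) ^+ 2)%:E = 0)%E.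
  apply/eqP; rewrite eq_le; apply/andP; split; last first.
    by apply: integral_ge0 => w _; rewrite lee_fin sqr_ge0.
  by apply: (cvge_to_ge lim0); apply: nearW.
move=> /(_ (measurable_funB mZ mZs)).
by apply: filterS => w /(_ I) /eqP; rewrite subr_eq0 => /eqP.
Unshelve. all: end_near. Qed.

Lemma expectation_sqr_convex_le (m : nat) (c : 'I_m -> R) (Z : T -> R)
    (Z_ : 'I_m -> T -> R) :
  (forall i, 0 <= c i) -> \sum_(i < m) c i = 1 ->
  measurable_fun setT Z -> (forall i, measurable_fun setT (Z_ i)) ->
  {ae P, forall w, Z w = \sum_(i < m) c i * Z_ i w} ->
  ('E_P[fun w => (Z w ^+ 2)%R] <=
   \sum_(i < m) (c i)%:E * 'E_P[fun w => (Z_ i w ^+ 2)%R])%E.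
Proof.
move=> c0 c1 mZ mZ_ ZE.
under eq_bigr do rewrite expectation_sqr.
apply: le_trans (integral_sqr_convex _ _ _ _ _) => //.
rewrite expectation_sqr le_eqVlt; apply/orP; left; apply/eqP.
apply: ge0_ae_eq_integral => //.
- by apply/measurable_EFinP; exact: measurable_funX.
- apply/measurable_EFinP/measurable_funX/measurable_sum => i.
  by apply: measurable_funM => //; exact: measurable_cst.
- by move=> w _; rewrite lee_fin sqr_ge0.
- by move=> w _; rewrite lee_fin sqr_ge0.
- by apply: filterS ZE => w -> _.
Qed.

End mean_square_limits.

(** * Normal second moment *)

Section normal_second_moment.
Variable R : realType.
Local Notation mu := (@lebesgue_measure R).

(** The Radon-Nikodym derivative of the normal law and [normal_pdf] have the same integral over
    every measurable set, hence agree almost everywhere. *)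
Lemma ge0_integral_normal_prob (m s : R) (f : R -> \bar R) :
  measurable_fun setT f -> (forall x, 0 <= f x)%E ->
  (\int[normal_prob m s]_x f x = \int[mu]_x (f x * (normal_pdf m s x)%:E))%E.
Proof.
move=> mf f0.
have dom : normal_prob m s `<< mu by exact: normal_prob_dominates.
rewrite -(Radon_Nikodym_SigmaFinite.change_of_variables dom)//.
apply: ae_eq_integral => //.
- apply: emeasurable_funM => //.
  exact: measurable_int (Radon_Nikodym_SigmaFinite.f_integrable dom).
- by apply: emeasurable_funM => //; apply/measurable_EFinP; exact: measurable_normal_pdf.
- apply: ae_eqe_mul2l => /=; apply: integral_ae_eq => //.
  + exact: Radon_Nikodym_SigmaFinite.f_integrable.
  + by apply/measurable_EFinP; exact: measurable_normal_pdf.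
  + by move=> E _ mE; rewrite -Radon_Nikodym_SigmaFinite.f_integral.
Qed.

Definition normal_sqmoment : \bar R := (\int[normal_prob 0 1]_x (x ^+ 2)%:E)%E.

Let sqmoment_pdf (s : R) :
  (\int[normal_prob 0 s]_x (x ^+ 2)%:E =
   \int[mu]_x (x ^+ 2 * normal_pdf 0 s x)%:E)%E.
Proof.
rewrite ge0_integral_normal_prob//.
- by apply/measurable_EFinP; exact: measurable_funX.
- by move=> x; rewrite lee_fin sqr_ge0.
Qed.

Lemma normal_sqmoment_ge0 : (0 <= normal_sqmoment)%E.
Proof. by apply: integral_ge0 => x _; rewrite lee_fin sqr_ge0. Qed.

(** Since [x^2 / 4 <= exp(x^2 / 4)], the function [x^2 exp(-x^2 / 2)] is at most [4 exp(-x^2 / 4)],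
    a multiple of the normal density of variance 2. *)
Lemma normal_sqmoment_lty : (normal_sqmoment < +oo)%E.
Proof.
rewrite /normal_sqmoment sqmoment_pdf.
pose r : R := Num.sqrt 2.
have r0 : r != 0 by rewrite gt_eqF// sqrtr_gt0.
(* The 4 comes from the bound on [x^2 / 4]; the quotient of peaks exchanges the normalizing
   constants for standard deviations 1 and [r]. *)
pose K := 4 * normal_peak 1 / normal_peak r.
have K0 : 0 <= K.
  by rewrite divr_ge0 ?mulr_ge0// ?normal_peak_ge0.
apply: (@le_lt_trans _ _ (\int[mu]_x (K%:E * (normal_pdf 0 r x)%:E))%E).
  apply: ge0_le_integral => //.
  - by move=> x _; rewrite lee_fin mulr_ge0 ?sqr_ge0 ?normal_pdf_ge0.
  - apply/measurable_EFinP/measurable_funM; first exact: measurable_funX.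
    exact: measurable_normal_pdf.
  - by apply: measurable_funeM; apply/measurable_EFinP; exact: measurable_normal_pdf.
  - move=> x _; rewrite -EFinM lee_fin !normal_pdfE ?oner_neq0//.
    rewrite /normal_fun subr0 /r sqr_sqrtr// expr1n.
    have -> : - x ^+ 2 / (2 *+ 2) = - (x ^+ 2 / 4) by field.
    have -> : - x ^+ 2 / (1 *+ 2) = - (x ^+ 2 / 4) + - (x ^+ 2 / 4) by field.
    rewrite expRD expRN.
    have h : x ^+ 2 / 4 <= expR (x ^+ 2 / 4).
      by apply: le_trans (expR_ge1Dx _); rewrite lerDr.
    have e0 := expR_gt0 (x ^+ 2 / 4); move: h e0; set e := expR _ => h e0.
    have pr : normal_peak r != 0 by rewrite gt_eqF ?normal_peak_gt0.
    have -> : K * (normal_peak r * e^-1) = 4 * (normal_peak 1 * e^-1).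
      by rewrite /K; field; rewrite pr gt_eqF.
    have -> : x ^+ 2 * (normal_peak 1 * (e^-1 * e^-1)) =
        (x ^+ 2 / e) * (normal_peak 1 * e^-1) by ring.
    rewrite ler_wpM2r ?mulr_ge0 ?normal_peak_ge0 ?invr_ge0 ?(ltW e0)//.
    by rewrite ler_pdivrMr// -ler_pdivrMl// mulrC.
rewrite integralZl//; last exact: integrable_normal_pdf.
by rewrite integral_normal_pdf mule1 ltry.
Qed.

(** Substitution [x = s * y]: the density scales by [s^-1], which the Jacobian [s] cancels, and the
    square contributes [s ^+ 2]. *)
Lemma integral_normal_sqr (s : R) : 0 < s ->
  (\int[normal_prob 0 s]_x (x ^+ 2)%:E = (s ^+ 2)%:E * normal_sqmoment)%E.
Proof.
move=> s0; rewrite /normal_sqmoment !sqmoment_pdf.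
have s0' : s != 0 by rewrite gt_eqF.
pose F (x : R) := s * x.
have F'E : F^`()%classic = cst s.
  by apply/funext => x; rewrite /F derive1E deriveM// derive_id derive_cst
    scaler0 addr0 [LHS]mulr1.
pose G x := x ^+ 2 * normal_pdf 0 s x.
have -> : (\int[mu]_x (x ^+ 2 * normal_pdf 0 s x)%:E = \int[mu]_x (G x)%:E)%E by [].
rewrite (@increasing_ge0_integration_by_substitutionT _ F G).
- rewrite -ge0_integralZl ?lee_fin ?sqr_ge0//; last 2 first.
  + apply/measurable_EFinP/measurable_funM; first exact: measurable_funX.
    exact: measurable_normal_pdf.
  + by move=> x _; rewrite lee_fin mulr_ge0 ?sqr_ge0 ?normal_pdf_ge0.
  apply: eq_integral => x _; rewrite F'E /= -EFinM; congr EFin.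
  rewrite /G /F !normal_pdfE ?oner_neq0//.
  rewrite -[LHS]/((s * x) ^+ 2 * (normal_peak s * normal_fun 0 s (s * x)) * s).
  have -> : normal_fun 0 s (s * x) = normal_fun 0 1 x.
    by rewrite /normal_fun !subr0; congr expR; rewrite exprMn expr1n; field.
  have -> : normal_peak s = s^-1 * normal_peak 1.
    rewrite /normal_peak expr1n mul1r -mulrnAr sqrtrM ?sqr_ge0// invfM.
    by rewrite sqrtr_sqr gtr0_norm.
  by field.
- by move=> x y xy; rewrite /F ltr_pM2l.
- by rewrite F'E => ?; exact: cvg_cst.
- by rewrite F'E; exact: is_cvg_cst.
- by rewrite F'E; exact: is_cvg_cst.
- by [].
- by apply: gt0_cvgMrNy => //; exact: cvg_id.
- by apply: gt0_cvgMry => //; exact: cvg_id.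
- move=> x; apply: cvgM; last exact: continuous_normal_pdf.
  exact: exprn_continuous.
- by move=> x; rewrite mulr_ge0 ?sqr_ge0 ?normal_pdf_ge0.
Qed.
End normal_second_moment.

(** * Square-integrable functions and covariances of increments *)

Section square_integrable.
Context d (T : measurableType d) (R : realType) (mu : {measure set T -> \bar R}).
Variable D : set T.
Hypothesis mD : measurable D.

(** For Lebesgue measure on an interval this unfolds to [L2]; a general measure lets the same
    expansions serve under [P]. *)
Definition square_integrable (f : T -> R) : Prop :=
  measurable_fun D f /\ mu.-integrable D (fun x => (f x ^+ 2)%:E).

(** Domination by [f x ^+ 2 + g x ^+ 2]. *)
Lemma square_integrableM (f g : T -> R) :
  square_integrable f -> square_integrable g ->
  mu.-integrable D (EFin \o (fun x => f x * g x)).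
Proof.
move=> [mf f2] [mg g2].
apply: (le_integrable mD _ _ (integrableD mD f2 g2)).
  by apply/measurable_EFinP; exact: measurable_funM.
move=> x _; rewrite -EFinD !abse_EFin lee_fin [leRHS]ger0_norm ?addr_ge0 ?sqr_ge0//.
rewrite normrM -(real_normK (num_real (f x))) -(real_normK (num_real (g x))).
by have := sqr_ge0 (`|f x| - `|g x|); have := normr_ge0 (f x); have := normr_ge0 (g x); nra.
Qed.

Lemma Rintegral_sum (J : Type) (r : seq J) (f : J -> T -> R) :
  (forall j, mu.-integrable D (EFin \o f j)) ->
  Rintegral mu D (fun x => \sum_(j <- r) f j x) = \sum_(j <- r) Rintegral mu D (f j).
Proof.
move=> fi; rewrite /Rintegral.
under eq_integral do rewrite -sumEFin.
rewrite (@integral_sum _ _ _ mu _ mD _ (fun j x => (f j x)%:E))//.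
by rewrite -sum_fine// => j _; exact: (integrable_fin_num mD (fi j)).
Qed.

Lemma integrable_sum_EFin (J : Type) (r : seq J) (f : J -> T -> R) :
  (forall j, mu.-integrable D (EFin \o f j)) ->
  mu.-integrable D (EFin \o (fun x => \sum_(j <- r) f j x)).
Proof.
move=> fi; rewrite (_ : _ \o _ = fun x => (\sum_(j <- r) (EFin \o f j) x)%E).
  exact: integrable_sum.
by apply/funext => x /=; rewrite sumEFin.
Qed.

Lemma integrableZl_EFin (a : R) (f : T -> R) :
  mu.-integrable D (EFin \o f) -> mu.-integrable D (EFin \o (fun x => a * f x)).
Proof.
by move=> fi; apply: eq_integrable (integrableZl mD a fi) => // x _ /=; rewrite EFinM.
Qed.

Section linear_combination.
Variables (J : finType) (c : J -> R) (h : J -> T -> R).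
Hypothesis h2 : forall j, square_integrable (h j).

Let sqrE (x : T) : (\sum_j c j * h j x) ^+ 2 =
  \sum_i \sum_j (c i * c j) * (h i x * h j x).
Proof.
rewrite expr2 mulr_suml; apply: eq_bigr => i _.
by rewrite mulr_sumr; apply: eq_bigr => j _; ring.
Qed.

Lemma square_integrable_sum : square_integrable (fun x => \sum_j c j * h j x).
Proof.
split.
  apply: measurable_sum => j; apply: measurable_funM; first exact: measurable_cst.
  by case: (h2 j).
under eq_fun do rewrite sqrE.
apply: integrable_sum_EFin => i; apply: integrable_sum_EFin => j.
by apply: integrableZl_EFin; exact: square_integrableM.
Qed.

Lemma Rintegral_sqr_sum :
  Rintegral mu D (fun x => (\sum_j c j * h j x) ^+ 2) =
  \sum_i \sum_j (c i * c j) * Rintegral mu D (fun x => h i x * h j x).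
Proof.
under eq_Rintegral do rewrite sqrE.
have ij i j : mu.-integrable D (EFin \o (fun x => c i * c j * (h i x * h j x))).
  by apply: integrableZl_EFin; exact: square_integrableM.
rewrite Rintegral_sum; last by move=> i; exact: integrable_sum_EFin.
apply: eq_bigr => i _; rewrite Rintegral_sum//; apply: eq_bigr => j _.
by rewrite RintegralZl//; exact: square_integrableM.
Qed.

End linear_combination.

Lemma square_integral_EFin (f : T -> R) : square_integrable f ->
  (\int[mu]_(x in D) (f x ^+ 2)%:E = (Rintegral mu D (fun x => (f x ^+ 2)%R))%:E)%E.
Proof. by move=> [_ f2]; rewrite /Rintegral fineK//; exact: integrable_fin_num. Qed.

(** Cauchy-Schwarz with a slack of 1 in the second factor, which keeps the denominator positive even
    when [g] vanishes almost everywhere. *)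
Lemma Rintegral_cauchy_schwarz1 (f g : T -> R) :
  square_integrable f -> square_integrable g ->
  (Rintegral mu D (fun x => f x * g x)) ^+ 2 <=
  Rintegral mu D (fun x => f x ^+ 2) * (Rintegral mu D (fun x => g x ^+ 2) + 1).
Proof.
move=> f2 g2.
(* The combination [f + y * g] is written as a sum over [bool], so that [Rintegral_sqr_sum] expands
   its square. *)
pose c y (b : bool) : R := if b then y else 1.
pose h (b : bool) x := if b then g x else f x.
have hh b : square_integrable (h b) by case: b.
have q y : 0 <= Rintegral mu D (fun x => (\sum_b c y b * h b x) ^+ 2).
  by apply: Rintegral_ge0 => x _; rewrite sqr_ge0.
move: q; set A := Rintegral mu D (fun x => f x ^+ 2).
set B := Rintegral mu D (fun x => f x * g x).
set G := Rintegral mu D (fun x => g x ^+ 2) => q.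
have G0 : 0 <= G by apply: Rintegral_ge0 => x _; rewrite sqr_ge0.
have {}q y : 0 <= A + 2 * y * B + y ^+ 2 * G.
  have := q y; rewrite Rintegral_sqr_sum// !big_bool /c /h /=.
  have -> : Rintegral mu D (fun x => g x * f x) = B.
    by apply: eq_Rintegral => x _; rewrite mulrC.
  rewrite -/A -/B -/G.
  by move=> h0; apply: le_trans h0 _; rewrite le_eqVlt; apply/orP; left; apply/eqP; ring.
have G1 : 0 < G + 1 by lra.
(* For [G > 0] the quadratic in [y] is minimal at [- B / G]; replacing [G] by [G + 1] costs only the
   nonnegative term [B ^+ 2 / (G + 1)]. *)
have := q (- B / (G + 1)).
have -> : A + 2 * (- B / (G + 1)) * B + (- B / (G + 1)) ^+ 2 * G =
    (A * (G + 1) - B ^+ 2 - B ^+ 2 / (G + 1)) / (G + 1).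
  by field; rewrite gt_eqF.
rewrite pmulr_lge0 ?invr_gt0// => h0.
have : 0 <= B ^+ 2 / (G + 1) by rewrite divr_ge0 ?sqr_ge0// ltW.
by lra.
Qed.

End square_integrable.

Section brownian_isometry.
Context d (T : measurableType d) (R : realType) (P : probability T R).

(* Length of the intersection of [`]a, b]] and [`]c, e]] when [a <= b] and
   [c <= e], in the form given by polarization. *)
Definition overlap (a b c e : R) : R :=
  (`|e - a| + `|b - c| - `|b - e| - `|a - c|) / 2.

(* [C] is the variance of the standard normal law; its value 1 plays no role. *)
Let C : R := fine (normal_sqmoment R).

Lemma normal_RV_sqr (s : R) (X : T -> R) : 0 < s -> measurable_fun setT X ->
  normal_RV P 0 s X ->
  square_integrable P setT X /\ Rintegral P setT (fun w => X w ^+ 2) = C * s ^+ 2.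
Proof.
move=> s0 mX nX.
(* Packaged as a random variable so that the integral can be transported to its law. *)
pose X' : {RV P >-> measurableTypeR R} :=
  @mfun_Sub _ _ T (measurableTypeR R) X (mem_set mX).
have msq : measurable_fun setT (fun x : R => (x ^+ 2)%:E).
  by apply/measurable_EFinP; exact: measurable_funX.
have E : (\int[P]_w (X w ^+ 2)%:E = (C * s ^+ 2)%:E)%E.
  transitivity (\int[distribution P X']_x (x ^+ 2)%:E)%E.
    by rewrite ge0_integral_distribution// => y; rewrite lee_fin sqr_ge0.
  transitivity (\int[normal_prob 0 s]_x (x ^+ 2)%:E)%E.
    by apply: eq_measure_integral => A mA _; exact: nX.
  rewrite integral_normal_sqr// [RHS]EFinM muleC /C fineK//.
  by rewrite ge0_fin_numE ?normal_sqmoment_lty ?normal_sqmoment_ge0.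
split; last by rewrite /Rintegral E.
split=> //; apply/integrableP; split.
  by apply/measurable_EFinP; exact: measurable_funX.
by under eq_integral do rewrite gee0_abs ?lee_fin ?sqr_ge0//; rewrite E ltry.
Qed.

Context (I : interval R) (t0 : R) (W : R -> {RV P >-> R}).
Hypothesis BW : brownian_motion I t0 W.

Let mW t : measurable_fun setT (W t). Proof. exact: measurable_funPT. Qed.

Lemma brownian_sqr (s t : R) : s \in I -> t \in I ->
  square_integrable P setT (fun w => W t w - W s w) /\
  Rintegral P setT (fun w => (W t w - W s w) ^+ 2) = C * `|t - s|.
Proof.
case: BW => _ _ N _ sI tI.
(* The law of an increment is prescribed only for [s < t]; the claim is symmetric in [s] and [t],
   and the case [s = t] is degenerate. *)
wlog st : s t sI tI / s <= t.
  move=> h; have [/h|/ltW ts] := leP s t; first exact.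
  have [[m2 i2] E] := h _ _ tI sI ts.
  split; [split|].
  - exact: measurable_funB.
  - by apply: eq_integrable i2 => // w _; rewrite -sqrrN opprB.
  - rewrite distrC -E; apply: eq_Rintegral => w _; by rewrite -sqrrN opprB.
move: st; rewrite le_eqVlt => /predU1P[<-|st].
  under [X in Rintegral _ _ X]eq_fun do rewrite subrr expr0n /=.
  rewrite subrr normr0 mulr0 Rintegral_cst// mul0r; split => //; split.
    exact: measurable_funB.
  by under eq_fun do rewrite subrr expr0n /=; exact: integrable0.
have s0 : 0 < Num.sqrt (t - s) by rewrite sqrtr_gt0 subr_gt0.
have mX : measurable_fun setT (fun w => W t w - W s w) by exact: measurable_funB.
have [h1 h2] := normal_RV_sqr s0 mX (N _ _ sI tI st).
split => //; rewrite ger0_norm ?subr_ge0 ?ltW//.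
by rewrite -[X in C * X](@sqr_sqrtr _ (t - s)) ?subr_ge0 ?ltW.
Qed.

Lemma brownian_covariance (a b c e : R) :
  a \in I -> b \in I -> c \in I -> e \in I ->
  Rintegral P setT (fun w => (W b w - W a w) * (W e w - W c w)) =
  C * overlap a b c e.
Proof.
move=> aI bI cI eI.
have int s t : s \in I -> t \in I ->
    P.-integrable setT (EFin \o (fun w => (W t w - W s w) ^+ 2)).
  by move=> sI tI; case: (brownian_sqr sI tI) => -[].
have E s t : s \in I -> t \in I ->
    Rintegral P setT (fun w => (W t w - W s w) ^+ 2) = C * `|t - s|.
  by move=> sI tI; case: (brownian_sqr sI tI).
have -> : Rintegral P setT (fun w => (W b w - W a w) * (W e w - W c w)) =
  Rintegral P setT (fun w => 2^-1 * (((W e w - W a w) ^+ 2 + (W b w - W c w) ^+ 2) -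
    ((W b w - W e w) ^+ 2 + (W a w - W c w) ^+ 2))).
  by apply: eq_Rintegral => w _; field.
have i1 := integrableD measurableT (int _ _ aI eI) (int _ _ cI bI).
have i2 := integrableD measurableT (int _ _ eI bI) (int _ _ cI aI).
rewrite RintegralZl//; last exact: (integrableB measurableT i1 i2).
rewrite RintegralB// !RintegralD ?E//; [|exact: int..].
by rewrite /overlap; field.
Qed.

Lemma square_integrable_indic_itv (a b : R) :
  square_integrable (@lebesgue_measure R) [set` I] \1_(`]a, b]%classic).
Proof.
split; first exact: measurable_indic.
have : (@lebesgue_measure R).-integrable [set` I] (EFin \o \1_(`]a, b]%classic)).
  by apply: (integrableS measurableT) => //; exact: integrable_indic_itv.
apply: eq_integrable => // x _ /=.
by rewrite indicE; case: (x \in _); rewrite ?expr1n ?expr0n.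
Qed.

Lemma itv_oc_sub (a b : R) : a \in I -> b \in I -> `]a, b]%classic `<=` [set` I].
Proof.
move=> aI bI x /=; rewrite in_itv /= => /andP[/ltW ax xb].
by apply: (@interval_is_interval _ I a b) => //; rewrite ax xb.
Qed.

(** The product of indicators is that of []max a c, min b e]], which lies in [I] as part of []a,
    b]]. Its length agrees with the polarized formula in every admissible order of the endpoints. *)
Lemma lebesgue_overlap (a b c e : R) :
  a \in I -> b \in I -> a <= b -> c <= e ->
  Rintegral (@lebesgue_measure R) [set` I]
    (fun x => \1_(`]a, b]%classic) x * \1_(`]c, e]%classic) x) = overlap a b c e.
Proof.
move=> aI bI ab ce.
have -> : Rintegral (@lebesgue_measure R) [set` I]
    (fun x => \1_(`]a, b]%classic) x * \1_(`]c, e]%classic) x) =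
  Rintegral (@lebesgue_measure R) [set` I]
    (\1_(`]Order.max a c, Order.min b e]%classic)).
  apply: eq_Rintegral => x _; rewrite !indicE !mem_setE !in_itv /=.
  rewrite gt_max le_min -natrM mulnb; congr (_%:R).
  by congr nat_of_bool; case: (a < x); case: (c < x); case: (x <= b); case: (x <= e).
rewrite /Rintegral integral_indic// setIidl; last first.
  apply: subset_trans (itv_oc_sub aI bI) => x /=; rewrite !in_itv /=.
  by rewrite gt_max le_min => /andP[/andP[-> _] /andP[->]].
transitivity (fine (if (Order.max a c)%:E < (Order.min b e)%:E
    then (Order.min b e)%:E - (Order.max a c)%:E else 0)%E).
  by congr fine; exact: (lebesgue_measure_itv `]Order.max a c, Order.min b e]).
rewrite lte_fin /overlap.
case: (leP a c) => ac; case: (leP b e) => be; case: ifPn => /=; rewrite -?leNgt => h;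
case: (ger0P (e - a)) => h1; case: (ger0P (b - c)) => h2;
case: (ger0P (b - e)) => h3; case: (ger0P (a - c)) => h4; lra.
Qed.

End brownian_isometry.

(** * Stochastic integrals of deterministic functions *)

Lemma wn_step_measurable d (T : measurableType d) (R : realType)
    (P : probability T R) (n : R) (I : interval R) (t0 : R)
    (W : R -> {RV P >-> R}) (g : R -> R) (m : nat) (c t : nat -> R) :
  (forall j, t j \in I) ->
  measurable_fun setT
    (fun w => step_integral m c t (fun j => wn_observation n I t0 W g w (t j))).
Proof.
move=> tI.
have mY s : s \in I -> measurable_fun setT (fun w => wn_observation n I t0 W g w s).
  move=> sI; rewrite /wn_observation; under eq_fun do rewrite patchE mem_set//.
  by apply: measurable_funD => //; exact: measurable_funM.
apply: measurable_sum => j; apply: measurable_funM => //.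
by apply: measurable_funB; exact: mY.
Qed.

Section white_noise_integral.
Context d (T : measurableType d) (R : realType) (P : probability T R).
Context (I : interval R) (t0 : R) (W : R -> {RV P >-> R}).
Hypothesis BW : brownian_motion I t0 W.
Local Notation mu := (@lebesgue_measure R).
Let C : R := fine (normal_sqmoment R).

Let mI : @measurable _ (measurableTypeR R) [set` I].
Proof. exact: measurable_itv. Qed.

(** Indicators over the fixed domain [I] turn the signed integral from [t0] into an expression
    linear in [g], whatever the position of [t0]. *)
Lemma drift_increment (g : R -> R) (a b : R) : L2 I g ->
  a \in I -> b \in I -> a <= b ->
  drift g t0 b - drift g t0 a =
  Rintegral mu [set` I] (fun x => \1_(`]a, b]%classic) x * g x).
Proof.
move=> g2 aI bI ab; case: BW => -[tI _] _ _ _.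
have int p q : mu.-integrable [set` I] (EFin \o (fun x => \1_(`]p, q]%classic) x * g x)).
  by apply: square_integrableM => //; exact: square_integrable_indic_itv.
have itvE p q : p \in I -> q \in I -> Rintegral mu `[p, q] g =
    Rintegral mu [set` I] (fun x => \1_(`]p, q]%classic) x * g x).
  move=> pI qI; have sub := itv_oc_sub pI qI.
  have intpq : mu.-integrable `]p, q] (EFin \o g).
    have : mu.-integrable `]p, q] (EFin \o (fun x => \1_(`]p, q]%classic) x * g x)).
      by apply: (integrableS mI _ sub (int p q)); exact: measurable_itv.
    apply: eq_integrable => // x xpq; rewrite /= indicE.
    by move: xpq; rewrite inE => xpq; rewrite mem_set// mul1r.
  rewrite -Rintegral_itv_obnd_cbnd//.
  rewrite -{1}(setIidr sub) Rintegral_mkcondr; apply: eq_Rintegral => x _.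
  by rewrite patchE indicE; case: (x \in _); rewrite ?mul1r ?mul0r.
(* One formula for both signs: at least one of the two intervals is empty. *)
have driftE t : t \in I -> drift g t0 t =
    Rintegral mu [set` I] (fun x => \1_(`]t0, t]%classic) x * g x) -
    Rintegral mu [set` I] (fun x => \1_(`]t, t0]%classic) x * g x).
  move=> tI'; rewrite /drift; case: (leP t0 t) => t0t.
    rewrite (set_itv_ge (b1 := BRight t)); last by rewrite bnd_simp -leNgt.
    rewrite indic0 itvE// [X in _ - X](_ : _ = 0) ?subr0//.
    by under eq_Rintegral do rewrite mul0r; rewrite Rintegral_cst// mul0r.
  rewrite (set_itv_ge (b1 := BRight t0)); last by rewrite bnd_simp -leNgt ltW.
  rewrite indic0 itvE// [X in X - _](_ : _ = 0) ?sub0r//.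
  by under eq_Rintegral do rewrite mul0r; rewrite Rintegral_cst// mul0r.
rewrite !driftE// -!RintegralB//; [|exact: (integrableB mI (int _ _) (int _ _))..].
apply: eq_Rintegral => x _; rewrite -!mulrBl; congr (_ * _).
(* What remains is additivity of signed intervals, checked by locating [x] relative to [t0], [a] and
   [b]. *)
rewrite !indicE !mem_setE !in_itv /=.
case: (ltP t0 x) => h1; case: (leP x b) => h2; case: (ltP b x) => h3;
case: (leP x t0) => h4; case: (leP x a) => h5; case: (ltP a x) => h6;
rewrite /= ?subr0 ?sub0r ?subrr ?oppr0 ?opprK//; lra.
Qed.

Lemma wn_increment (n : R) (g : R -> R) (a b : R) (w : T) : L2 I g ->
  a \in I -> b \in I -> a <= b ->
  wn_observation n I t0 W g w b - wn_observation n I t0 W g w a =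
  Rintegral mu [set` I] (fun x => \1_(`]a, b]%classic) x * g x) +
  n `^ (- 2^-1) * (W b w - W a w).
Proof.
move=> g2 aI bI ab; rewrite -drift_increment// /wn_observation !patchE !mem_set//.
by ring.
Qed.

Section step_combination.
Variables (J : finType) (c a b : J -> R).
Hypothesis abI : forall j, [/\ a j \in I, b j \in I & a j <= b j].

Let s x := \sum_j c j * \1_(`]a j, b j]%classic) x.

Lemma step_combination_square_integrable : square_integrable mu [set` I] s.
Proof.
apply: square_integrable_sum => // j; exact: square_integrable_indic_itv.
Qed.

(** Both squares expand into double sums whose terms match by [brownian_covariance] and
    [lebesgue_overlap]. The intervals may overlap, which allows two unrelated grids to be
    combined. *)
Lemma brownian_isometry :
  (\int[P]_w ((\sum_j c j * (W (b j) w - W (a j) w)) ^+ 2)%:E =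
   C%:E * \int[mu]_(x in [set` I]) (s x ^+ 2)%:E)%E.
Proof.
have hW j : square_integrable P setT (fun w => W (b j) w - W (a j) w).
  by have [aI bI _] := abI j; have [] := brownian_sqr BW aI bI.
rewrite (square_integral_EFin _ (square_integrable_sum _ c hW))//.
rewrite (square_integral_EFin _ step_combination_square_integrable)// -EFinM.
rewrite !Rintegral_sqr_sum//; last by move=> j; exact: square_integrable_indic_itv.
congr EFin; rewrite mulr_sumr; apply: eq_bigr => i _.
rewrite mulr_sumr; apply: eq_bigr => j _.
have [aI bI ab] := abI i; have [aJ bJ abj] := abI j.
rewrite (brownian_covariance BW)// lebesgue_overlap// -/C; ring.
Qed.

(** The combination is the deterministic number [B], the integral of [s * g], plus scaled noise. The
    resulting factor depends on [n] and [g] but not on the step function. *)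
Lemma wn_step_bound (n : R) (g : R -> R) : L2 I g ->
  (\int[P]_w ((\sum_j c j *
      (wn_observation n I t0 W g w (b j) - wn_observation n I t0 W g w (a j))) ^+ 2)%:E
   <= (2 * (Rintegral mu [set` I] (fun x => g x ^+ 2) + 1)
       + 2 * (n `^ (- 2^-1)) ^+ 2 * C)%:E * \int[mu]_(x in [set` I]) (s x ^+ 2)%:E)%E.
Proof.
move=> g2; set sg := n `^ (- 2^-1).
have s2 := step_combination_square_integrable.
pose B := Rintegral mu [set` I] (fun x => s x * g x).
pose N w := \sum_j c j * (W (b j) w - W (a j) w).
have mN : measurable_fun setT N.
  apply: measurable_sum => j; apply: measurable_funM; first exact: measurable_cst.
  by apply: measurable_funB; exact: measurable_funPT.
have BE : B = \sum_j c j *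
    Rintegral mu [set` I] (fun x => \1_(`]a j, b j]%classic) x * g x).
  pose h j x := \1_(`]a j, b j]%classic) x * g x.
  have ih j : mu.-integrable [set` I] (EFin \o h j).
    by apply: square_integrableM => //; exact: square_integrable_indic_itv.
  transitivity (Rintegral mu [set` I] (fun x => \sum_j c j * h j x)).
    apply: eq_Rintegral => x _; rewrite mulr_suml.
    by apply: eq_bigr => j _; rewrite mulrA.
  rewrite Rintegral_sum//; last by move=> j; exact: integrableZl_EFin.
  by apply: eq_bigr => j _; rewrite RintegralZl//; exact: ih.
under eq_integral => w _.
  rewrite [X in X ^+ 2](_ : _ = B + sg * N w); last first.
    rewrite BE /N mulr_sumr -big_split; apply: eq_bigr => j _ /=.
    by have [aI bI ab] := abI j; rewrite wn_increment// -/sg; ring.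
  over.
apply: le_trans (integral_sqrD_le _ _ _ _) _ => //.
  exact: measurable_funM.
rewrite integral_sqrZ// brownian_isometry.
rewrite integral_cst// [X in ((B ^+ 2)%:E * X)%E](_ : _ = 1%E) ?mule1; last exact: probability_setT.
rewrite (square_integral_EFin _ s2)// -!EFinM -EFinD lee_fin.
have := Rintegral_cauchy_schwarz1 mI s2 g2; rewrite -/B.
lra.
Qed.

End step_combination.

Lemma step_fun_square_integrable m (c t : nat -> R) :
  nondecreasing_seq t -> (forall j, t j \in I) ->
  square_integrable mu [set` I] (step_fun m c t).
Proof.
move=> ndt tI; apply: square_integrable_sum => // j.
exact: square_integrable_indic_itv.
Qed.

(** [K] is chosen before the step functions, so closeness of integrands in L2 transfers uniformly to
    their integrals. *)
Lemma wn_step_difference_bound (n : R) (g : R -> R) : L2 I g ->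
  exists K : R, forall (m m' : nat) (c c' t t' : nat -> R),
    nondecreasing_seq t -> (forall j, t j \in I) ->
    nondecreasing_seq t' -> (forall j, t' j \in I) ->
    (\int[P]_w ((step_integral m c t (fun j => wn_observation n I t0 W g w (t j)) -
       step_integral m' c' t' (fun j => wn_observation n I t0 W g w (t' j))) ^+ 2)%:E
     <= K%:E * \int[mu]_(x in [set` I]) ((step_fun m c t x - step_fun m' c' t' x) ^+ 2)%:E)%E.
Proof.
move=> g2.
exists (2 * (Rintegral mu [set` I] (fun x => g x ^+ 2) + 1)
       + 2 * (n `^ (- 2^-1)) ^+ 2 * C) => m m' c c' t t' ndt tI ndt' tI'.
(* Both grids form one family indexed by the disjoint sum, with the second coefficients negated. *)
pose cc (j : 'I_m + 'I_m') := match j with inl i => c i | inr i => - c' i end.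
pose a (j : 'I_m + 'I_m') := match j with inl i => t i | inr i => t' i end.
pose b (j : 'I_m + 'I_m') := match j with inl i => t i.+1 | inr i => t' i.+1 end.
have abI j : [/\ a j \in I, b j \in I & a j <= b j].
  by case: j => j; split => //=; [apply: ndt|apply: ndt']; exact: leqnSn.
have := wn_step_bound cc abI n g2.
under eq_integral => w _.
  rewrite big_sumType /= [X in _ + X](_ : _ = - step_integral m' c' t'
    (fun j => wn_observation n I t0 W g w (t' j))); last first.
    by rewrite -sumrN; apply: eq_bigr => j _; rewrite mulNr.
  over.
under [X in (_ <= _ * X)%E -> _]eq_integral => x _.
  rewrite big_sumType /= [X in _ + X](_ : _ = - step_fun m' c' t' x); last first.
    by rewrite -sumrN; apply: eq_bigr => j _; rewrite mulNr.
  over.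
by [].
Qed.

(* The mean-square limit does not depend on the approximating step functions,
   so a single sequence serves all drifts at once. *)
Lemma is_stochastic_integral_indep (n : R) (u g : R -> R) (Z : T -> R)
    (m : nat -> nat) (c t : nat -> nat -> R) :
  L2 I u -> L2 I g ->
  (forall k, nondecreasing_seq (t k) /\ forall j, t k j \in I) ->
  (\int[mu]_(x in [set` I]) ((step_fun (m k) (c k) (t k) x - u x) ^+ 2)%:E)%E
    @[k --> \oo] --> 0%E ->
  is_stochastic_integral P I u (wn_observation n I t0 W g) Z ->
  mean_square_cvg P (fun k w => step_integral (m k) (c k) (t k)
    (fun j => wn_observation n I t0 W g w (t k j))) Z.
Proof.
move=> u2 g2 tI su [m' [c' [t' [tI' su' [mZ ZS]]]]]; split=> //.
have [K hK] := wn_step_difference_bound n g2.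
(* [K] comes without a sign; its absolute value makes multiplication monotone. *)
pose K' := `|K|; have K'0 : 0 <= K' by exact: normr_ge0.
pose Y w (tt : nat -> R) j := wn_observation n I t0 W g w (tt j).
pose S k w := step_integral (m k) (c k) (t k) (Y w (t k)).
pose S' k w := step_integral (m' k) (c' k) (t' k) (Y w (t' k)).
pose e k := (\int[mu]_(x in [set` I]) ((step_fun (m k) (c k) (t k) x - u x) ^+ 2)%:E)%E.
pose e' k := (\int[mu]_(x in [set` I]) ((step_fun (m' k) (c' k) (t' k) x - u x) ^+ 2)%:E)%E.
pose z k := (\int[P]_w ((S' k w - Z w) ^+ 2)%:E)%E.
have mS k : measurable_fun setT (S k) by apply: wn_step_measurable; case: (tI k).
have mS' k : measurable_fun setT (S' k) by apply: wn_step_measurable; case: (tI' k).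
(* Pass from [S k] to [Z] through [S' k], and compare the two step functions through [u]. *)
have bound k : (\int[P]_w ((S k w - Z w) ^+ 2)%:E <=
    2%:E * (K'%:E * (2%:E * e k + 2%:E * e' k)) + 2%:E * z k)%E.
  have -> : (\int[P]_w ((S k w - Z w) ^+ 2)%:E =
     \int[P]_w (((S k w - S' k w) + (S' k w - Z w)) ^+ 2)%:E)%E.
    by apply: eq_integral => w _; rewrite addrA subrK.
  apply: le_trans (integral_sqrD_le _ _ _ _) _ => //; [exact: measurable_funB..|].
  rewrite leeD2r// lee_pmul2l//.
  have [[nd tk] [nd' tk']] := (tI k, tI' k).
  apply: le_trans (hK _ _ _ _ _ _ nd tk nd' tk') _.
  have m1 := (step_fun_square_integrable (m k) (c k) nd tk).1.
  have m2 := (step_fun_square_integrable (m' k) (c' k) nd' tk').1.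
  apply: (@le_trans _ _ (K'%:E * \int[mu]_(x in [set` I])
    ((step_fun (m k) (c k) (t k) x - step_fun (m' k) (c' k) (t' k) x) ^+ 2)%:E)%E).
    apply: lee_wpmul2r; last by rewrite lee_fin ler_norm.
    by apply: integral_ge0 => x _; rewrite lee_fin sqr_ge0.
  apply: lee_wpmul2l; first by rewrite lee_fin.
  have -> : (\int[mu]_(x in [set` I]) ((step_fun (m k) (c k) (t k) x -
      step_fun (m' k) (c' k) (t' k) x) ^+ 2)%:E = \int[mu]_(x in [set` I])
      (((step_fun (m k) (c k) (t k) x - u x) +
        (u x - step_fun (m' k) (c' k) (t' k) x)) ^+ 2)%:E)%E.
    by apply: eq_integral => x _; rewrite addrA subrK.
  have -> : e' k = (\int[mu]_(x in [set` I])
      ((u x - step_fun (m' k) (c' k) (t' k) x) ^+ 2)%:E)%E.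
    by apply: eq_integral => x _; rewrite -sqrrN opprB.
  by apply: integral_sqrD_le => //; apply: measurable_funB => //; case: u2.
have z0 : z k @[k --> \oo] --> 0%E.
  by move: ZS; under eq_fun do rewrite expectation_sqr.
under eq_fun do rewrite expectation_sqr.
apply: (@squeeze_cvge _ _ _ _ (cst 0%E) _
  (fun k => 2%:E * (K'%:E * (2%:E * e k + 2%:E * e' k)) + 2%:E * z k)%E).
- apply: nearW => k; rewrite bound andbT.
  by apply: integral_ge0 => w _; rewrite lee_fin sqr_ge0.
- exact: cvg_cst.
- rewrite (_ : 0%E = 2%:E * (K'%:E * (2%:E * 0 + 2%:E * 0)) + 2%:E * 0 :> \bar R)%E;
    last by rewrite !mule0 !adde0 !mule0.
  apply: cvgeD; first by rewrite !mule0 !adde0 !mule0.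
    apply: cvgeZl => //; apply: cvgeZl => //; apply: cvgeD.
    + by rewrite !mule0.
    + exact: cvgeZl.
    + exact: cvgeZl.
  exact: cvgeZl.
Qed.

End white_noise_integral.

(** * Risk over the convex hull *)

Section affine_step.
Context d (T : measurableType d) (R : realType) (P : probability T R).
Context (I : interval R) (t0 : R) (W : R -> {RV P >-> R}).
Hypothesis BW : brownian_motion I t0 W.
Local Notation mu := (@lebesgue_measure R).
Variables (J : finType) (c : J -> R) (g : J -> R -> R).
Hypothesis g2 : forall i, L2 I (g i).

Let mI : @measurable _ (measurableTypeR R) [set` I].
Proof. exact: measurable_itv. Qed.

Let sumE : \sum_i c i *: g i = (fun x => \sum_i c i * g i x).
Proof. by apply/funext => x; rewrite fct_sumE. Qed.

Lemma L2_sum : L2 I (\sum_i c i *: g i).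
Proof.
rewrite sumE.
have [] : square_integrable mu [set` I] (fun x => \sum_i c i * g i x).
  by apply: square_integrable_sum; [exact: mI|exact: g2].
by [].
Qed.

(** The drift part is linear in the parameter; the noise part is common to all parameters and is
    reproduced because the weights sum to 1. *)
Lemma wn_increment_affine (n a b : R) (w : T) : \sum_i c i = 1 ->
  a \in I -> b \in I -> a <= b ->
  wn_observation n I t0 W (\sum_i c i *: g i) w b -
    wn_observation n I t0 W (\sum_i c i *: g i) w a =
  \sum_i c i * (wn_observation n I t0 W (g i) w b - wn_observation n I t0 W (g i) w a).
Proof.
move=> c1 aI bI ab.
rewrite (wn_increment BW)//; last exact: L2_sum.
under [RHS]eq_bigr do rewrite (wn_increment BW)// mulrDr.
rewrite big_split -mulr_suml /= c1 mul1r; congr (_ + _).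
have int i : mu.-integrable [set` I] (EFin \o (fun x => \1_(`]a, b]%classic) x * g i x)).
  exact: (square_integrableM mI (square_integrable_indic_itv I a b) (g2 i)).
transitivity (Rintegral mu [set` I]
    (fun x => \sum_i c i * (\1_(`]a, b]%classic) x * g i x))).
  apply: eq_Rintegral => x _; rewrite sumE mulr_sumr.
  by apply: eq_bigr => i _; rewrite mulrCA.
rewrite Rintegral_sum//; last by move=> i; exact: integrableZl_EFin.
by apply: eq_bigr => i _; rewrite RintegralZl//; exact: int.
Qed.

End affine_step.

Section ell2_subspace.
Variable R : realType.

Lemma ell2_sum (J : finType) (c : J -> R) (g : J -> nat -> R) :
  (forall i, ell2 (g i)) -> ell2 (\sum_i c i *: g i).
Proof.
move=> g2; elim/big_ind: _ => [|f h f2 h2|i _].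
- rewrite /ell2 /=; under eq_fun do rewrite expr0n /=.
  by rewrite (_ : series _ = cst 0); [exact: is_cvg_cst|
    apply/funext => k; rewrite /series /= big1].
- apply: (@series_le_cvg _ _ (fun k => 2 * f k ^+ 2 + 2 * h k ^+ 2)).
  + by move=> k; rewrite sqr_ge0.
  + by move=> k; rewrite addr_ge0// mulr_ge0// sqr_ge0.
  + move=> k; rewrite -subr_ge0 (_ : _ - _ = (f k - h k) ^+ 2) ?sqr_ge0//.
    by rewrite -[(f + h) k]/(f k + h k); ring.
  + exact: (is_cvg_seriesD (is_cvg_seriesZ (k := 2) f2) (is_cvg_seriesZ (k := 2) h2)).
- rewrite /ell2 /=.
  under eq_fun do rewrite -[(c i *: g i) _]/(c i * g i _) exprMn.
  exact: (is_cvg_seriesZ (k := c i ^+ 2) (g2 i)).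
Qed.

End ell2_subspace.

Section convex_hull_risk.
Context (R : realType) (X : lmodType R).

Lemma linear_functional_on_sum (V : set X) (L : X -> R) (J : finType)
    (c : J -> R) (g : J -> X) : linear_functional_on V L ->
  (forall i, V (g i)) -> L (\sum_i c i *: g i) = \sum_i c i * L (g i).
Proof.
move=> [V0 VD LD] Vg.
have L0 : L 0 = 0 by have := LD 1 0 0 V0 V0; rewrite scaler0 addr0; lra.
(* Membership in [V] is carried along the induction, since [L] is linear on [V] only. *)
suff [] : V (\sum_i c i *: g i) /\ L (\sum_i c i *: g i) = \sum_i c i * L (g i) by [].
elim/big_rec2: _ => [//|i y x _ [Vx Lx]]; split; first exact: VD.
by rewrite LD// Lx.
Qed.

Lemma sub_convex_hull (F : set X) : F `<=` convex_hull F.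
Proof.
move=> f Ff; exists 1, (fun=> 1), (fun=> f); split => //.
  by rewrite big_ord1.
by rewrite big_ord1 scale1r.
Qed.

Context d (T : measurableType d) (P : probability T R).

Lemma mse_ge0 (D : Type) (Y : X -> T -> D) (L : X -> R) (That : D -> R) (f : X) :
  (0 <= mse P Y L That f)%E.
Proof.
by rewrite /mse expectation_sqr; apply: integral_ge0 => w _; rewrite lee_fin sqr_ge0.
Qed.

(** The class [E] is the same on both sides, so the suprema are compared for each estimator;
    convexity bounds the risk at a hull point by the supremum over [F]. *)
Lemma minimax_risk_convex_hull (D : Type) (Y : X -> T -> D) (E : set (D -> R))
    (L : X -> R) (F : set X) :
  (forall (That : D -> R) (m : nat) (c : 'I_m -> R) (g : 'I_m -> X),
    E That -> (forall i, F (g i)) -> (forall i, 0 <= c i) -> \sum_(i < m) c i = 1 ->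
    (mse P Y L That (\sum_(i < m) c i *: g i)%R <=
     \sum_(i < m) (c i)%:E * mse P Y L That (g i))%E) ->
  minimax_risk P Y E L F = minimax_risk P Y E L (convex_hull F).
Proof.
move=> convex; congr ereal_inf; apply: eq_imagel => That EThat.
apply/eqP; rewrite eq_le; apply/andP; split.
  by apply: ereal_sup_le => _ [f Ff <-]; exists f => //; exact: sub_convex_hull.
apply: ge_ereal_sup => _ [f [m [c [g [Fg c0 c1 ->]]]] <-].
apply: le_trans (convex _ _ _ _ EThat Fg c0 c1) _.
set M := ereal_sup _.
have gM i : (mse P Y L That (g i) <= M)%E.
  by apply: ereal_sup_ubound; exists (g i).
(* Weights summing to 1 force [m > 0], so [M] dominates some nonnegative risk; this excludes
   [-oo]. *)
case: m c g Fg c0 c1 gM => [|m] c g Fg c0 c1 gM.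
  by move: c1; rewrite big_ord0 => /esym/eqP; rewrite oner_eq0.
have M0 : (0 <= M)%E by apply: le_trans (gM ord0); exact: mse_ge0.
case: M M0 gM => [r||//] M0 gM; last by rewrite leey.
apply: (@le_trans _ _ (\sum_(i < m.+1) (c i)%:E * r%:E)%E).
  by apply: lee_sum => i _; apply: lee_wpmul2l => //; rewrite lee_fin.
under eq_bigr do rewrite -EFinM.
by rewrite sumEFin -mulr_suml c1 mul1r.
Qed.

(** Common to both models: [S] and [S_] approximate the linear part of the estimator, without the
    intercept [a], under [f] and under each [g i]. *)
Lemma mse_convex_of_mean_square_limit (D : Type) (Y : X -> T -> D) (L : X -> R)
    (That : D -> R) (a : R) (m : nat) (c : 'I_m -> R) (g : 'I_m -> X) (f : X)
    (S : nat -> T -> R) (S_ : 'I_m -> nat -> T -> R) :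
  (forall i, 0 <= c i) -> \sum_(i < m) c i = 1 ->
  L f = \sum_(i < m) c i * L (g i) ->
  (forall i k, measurable_fun setT (S_ i k)) ->
  (forall k w, S k w = \sum_(i < m) c i * S_ i k w) ->
  mean_square_cvg P S (fun w => That (Y f w) - a) ->
  (forall i, mean_square_cvg P (S_ i) (fun w => That (Y (g i) w) - a)) ->
  (mse P Y L That f <= \sum_(i < m) (c i)%:E * mse P Y L That (g i))%E.
Proof.
move=> c0 c1 Lf mS SE hf hg.
have mX h : measurable_fun setT (fun w => That (Y h w) - a) ->
    measurable_fun setT (fun w => That (Y h w) - L h).
  move=> mZ; rewrite (_ : (fun w => _) = fun w => (That (Y h w) - a) + (a - L h)).
    exact: measurable_funD.
  by apply/funext => w; rewrite addrA subrK.
apply: expectation_sqr_convex_le => //.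
- by apply: mX; case: hf.
- by move=> i; apply: mX; case: (hg i).
- have := mean_square_cvg_convex c0 c1 mS SE hf hg.
  (* Adding [a - L f] turns the limit into the estimation error; as the weights sum to 1, the
     constant [a] distributes over the [g i]. *)
  apply: filterS => w /(congr1 (fun x => x + (a - L f))).
  rewrite addrA subrK => ->.
  under eq_bigr do rewrite mulrBr.
  under [RHS]eq_bigr do rewrite mulrBr.
  by rewrite !sumrB -mulr_suml c1 mul1r Lf addrA subrK.
Qed.

End convex_hull_risk.

Theorem theorem5 (R : realType) (d : measure_display) (Omega : measurableType d)
    (P : probability Omega R) (n : R) (hn : 0 < n) :
  (forall (I : interval R) (t0 : R) (W : R -> {RV P >-> R})
      (V F : set (R -> R)) (L : (R -> R) -> R),
    brownian_motion I t0 W ->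
    linear_functional_on V L -> F `<=` V -> F `<=` L2 I ->
    wn_linear_minimax_risk n I t0 W L F =
    wn_linear_minimax_risk n I t0 W L (convex_hull F))
  /\
  (forall (eps : nat -> {RV P >-> R})
      (V F : set (nat -> R)) (L : (nat -> R) -> R),
    gaussian_white_sequence eps ->
    linear_functional_on V L -> F `<=` V -> F `<=` @ell2 R ->
    seq_linear_minimax_risk n eps L F =
    seq_linear_minimax_risk n eps L (convex_hull F)).
Proof.
split.
  move=> I t0 W V F L BW LV FV F2; apply: minimax_risk_convex_hull.
  move=> That m c g [a [u [u2 hThat]]] Fg c0 c1.
  have g2 i : L2 I (g i) by exact: F2.
  (* The step functions are those supplied for the hull point itself, which lies in [L2 I]. *)
  have [p [s [t [tI su hf]]]] := hThat _ (L2_sum c g2).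
  apply: (mse_convex_of_mean_square_limit (S_ := fun i k w => step_integral (p k)
    (s k) (t k) (fun j => wn_observation n I t0 W (g i) w (t k j))) c0 c1 _ _ _ hf).
  - by apply: (linear_functional_on_sum _ LV) => i; exact: FV.
  - by move=> i k; apply: wn_step_measurable; case: (tI k).
  - move=> k w; have [nd tk] := tI k; rewrite /step_integral.
    under eq_bigr => j _.
      rewrite (wn_increment_affine BW) ?mulr_sumr//; last by apply: nd; exact: leqnSn.
      over.
    rewrite exchange_big; apply: eq_bigr => i _.
    by rewrite mulr_sumr; apply: eq_bigr => j _; rewrite mulrCA.
  (* The sequence chosen for the hull point also computes the integral under each [g i]. *)
  - by move=> i; apply: (is_stochastic_integral_indep BW u2 (g2 i) tI su); exact: hThat.
move=> eps V F L _ LV FV F2; apply: minimax_risk_convex_hull.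
move=> That m c g [a [u [u2 hThat]]] Fg c0 c1.
have g2 i : ell2 (g i) by exact: F2.
(* Here the partial sums have the same coefficients for every parameter, so no change of
   approximating sequence occurs. *)
have hf := hThat _ (@ell2_sum _ _ c g g2).
apply: (mse_convex_of_mean_square_limit (S_ := fun i k w =>
  \sum_(j < k) u j * seq_observation n eps (g i) w j) c0 c1 _ _ _ hf).
- by apply: (linear_functional_on_sum _ LV) => i; exact: FV.
- move=> i k; apply: measurable_sum => j; apply: measurable_funM => //.
  by apply: measurable_funD => //; exact: measurable_funM.
- move=> k w; under [RHS]eq_bigr do rewrite mulr_sumr.
  rewrite exchange_big; apply: eq_bigr => j _ /=.
  under [RHS]eq_bigr do rewrite mulrCA.
  rewrite -mulr_sumr /seq_observation; congr (_ * _).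
  under [RHS]eq_bigr do rewrite mulrDr.
  by rewrite big_split -mulr_suml /= c1 mul1r fct_sumE.
- by move=> i; exact: hThat.
Qed.
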